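(* For each $\alpha \in [-\infty,\infty]$, let $$A(\alpha) := \left\{ x \in (0,1] : \lim_{n\to\infty} (d_n(x))^{1/n} = \alpha \right\}.$$ Then $\dim_H A(\alpha) = 1$ if $\alpha \in [1,\infty]$, and $\dim_H A(\alpha) = 0$ if $\alpha \in [-\infty,1)$, because in the latter case $A(\alpha) = \varnothing$.
   Context: Pierce expansion digits: for $x \in (0,1]$ put $d_1(x) := \lfloor 1/x \rfloor$ and $T(x) := 1 - d_1(x)x$, and for $k \in \mathbb{N}$ put $d_k(x) := d_1(T^{k-1}(x))$ provided $T^{k-1}(x) \neq 0$. All digits $d_k(x)$, $k \in \mathbb{N}$, are defined exactly when $x$ is irrational, and then they form a strictly increasing sequence of positive integers. Convention: a limiting condition on $(d_n(x))_n$, or a condition for all (large) $n$, is only considered for irrational $x$, so rational $x$ do not belong to sets defined by such conditions. $\mathbb{N}=\{1,2,\dots\}$, and $\dim_H$ is the Hausdorff dimension (with $\dim_H \varnothing = 0$). *)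

(* Defs.v *)
From HB Require Import structures.
From mathcomp Require Import all_boot all_order all_algebra.
From mathcomp Require Import all_classical all_reals all_analysis.

Set Implicit Arguments.
Unset Strict Implicit.
Unset Printing Implicit Defensive.
Import Order.TTheory GRing.Theory Num.Theory.
Import numFieldNormedType.Exports.

Local Open Scope classical_set_scope.
Local Open Scope ring_scope.

Section HausdorffDimension.
Variable R : realType.
Implicit Types (A U : set R) (s delta : R).

Definition diam U : \bar R :=
  ereal_sup [set `|p.1 - p.2|%:E | p in U `*` U].

(* The supremum defining [diam] is -oo on the empty set, and the empty set has
   weight 0 for every s, including s = 0; a nonempty set has weight 1 when
   s = 0. *)
Definition hausdorff_weight s U : \bar R :=
  if pselect (U = set0) then 0%E else (diam U `^ s)%E.

Definition delta_cover delta A (U : nat -> set R) : Prop :=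
  A `<=` \bigcup_i U i /\ forall i, (diam (U i) <= delta%:E)%E.

Definition hausdorff_premeasure s delta A : \bar R :=
  ereal_inf [set (\sum_(0 <= i <oo) hausdorff_weight s (U i))%E
            | U in delta_cover delta A].

Definition hausdorff_measure s A : \bar R :=
  ereal_sup [set hausdorff_premeasure s delta A
            | delta in [set delta | 0 < delta]].

Definition hausdorff_dim A : \bar R :=
  ereal_inf [set s%:E | s in [set s | 0 <= s /\ hausdorff_measure s A = 0%E]].

End HausdorffDimension.

Section PierceExpansion.
Variable R : realType.
Implicit Types x : R.

Definition pierce_digit1 x : int := Num.floor (1 / x).

Definition pierce_map x : R := 1 - (pierce_digit1 x)%:~R * x.

(* The k-th digit, k >= 1. If [iter k.-1 pierce_map x] is 0, which never happens
   for irrational x, the k-th digit does not exist and the value here is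
   meaningless; so is the value at k = 0. *)
Definition pierce_digit (k : nat) x : int :=
  pierce_digit1 (iter k.-1 pierce_map x).

(* Restricted to irrational x, for which all the digits exist. The convergence
   is in the topology of \bar R; the term n = 0 plays no role. *)
Definition digit_root_limit_set (alpha : \bar R) : set R :=
  [set x : R | [/\ 0 < x <= 1, irrational x &
    (((pierce_digit n x)%:~R `^ (1 / n%:R))%R)%:E @[n --> \oo] --> alpha]].

End PierceExpansion.

(* Main.v *)
Require Import Defs.
From mathcomp Require Import all_boot all_order all_algebra.
From mathcomp Require Import all_classical all_reals all_analysis.
From mathcomp Require Import ring lra zify.

Set Implicit Arguments.
Unset Strict Implicit.
Unset Printing Implicit Defensive.
Import Order.TTheory GRing.Theory Num.Theory.
Import numFieldNormedType.Exports.

Local Open Scope classical_set_scope.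
Local Open Scope ring_scope.

(** Digits are at least 1, so for [alpha < 1] the set is empty. For
    [1 <= alpha] it lies in the unit interval, hence has dimension at most 1,
    and the content of the theorem is the lower bound.

    Fix [s < 1]. Choose integers [a 0 < a 1 < ...] with [(a n)^(1/n)] tending to
    [alpha] and keep only the numbers whose digits, now numbered from 0, satisfy
    [a n <= d n < a n.+1] for every [n]; all of them belong to the set. There are
    [N n = a n.+1 - a n] admissible values for the [n]-th digit, whatever the
    other digits are, so these numbers are parametrised by [0, 1[: the [n]-th
    digit of the number attached to [t] is [a n] plus the [n]-th digit of [t]
    in the mixed-radix (Cantor) expansion with bases [N 0, N 1, ...]. If the
    digits attached to [t] and [t'] first differ at place [n], then

    - [`|t - t'|] is at most [1 / (N 0 * ... * N n.-1)]
      ([cantor_digits_dist]);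
    - the two Pierce numbers are at distance at least
      [1 / (a 1 * ... * a n.+2)] ([pierce_tail_separation]), because all the
      points with a given [n]-th digit stay away from one end of their Pierce
      cylinder: digit [n.+1] is bounded by [a n.+2].

    If [a n.+3 `^ s <= N n] for large [n], which only asks that the windows be,
    on a logarithmic scale, almost as long as the numbers in them, the first
    bound is at most a constant times the [s]-th power of the second. The
    parameter is then an [s]-Hoelder function of the Pierce number, and a cover
    of the set yields a cover of [0, 1[ by intervals whose lengths are controlled
    by the weights of the cover. Countable subadditivity of Lebesgue measure
    bounds the [s]-dimensional Hausdorff measure below
    ([hausdorff_measure_gt0_of_holder]).

    Taking [a n] close to [expR (g n)], the requirements become growth
    conditions on [g], met by [g n = c * n + 2 * sqrt n + 2] when
    [alpha = expR c] and by [g n = n ^ 2 + 2] when [alpha = +oo]. The square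
    root matters for [alpha = 1]: the digits must grow subexponentially but
    faster than any power of [n], since with polynomial growth the windows would
    be too short. *)

(** * Bounds on Hausdorff measure *)

Section HausdorffBounds.
Variable R : realType.
Implicit Types (A U : set R) (s : R).

Lemma diam_ge {U} {x y : R} : U x -> U y -> (`|x - y|%:E <= diam U)%E.
Proof. by move=> Ux Uy; apply: ereal_sup_ubound; exists (x, y). Qed.

Lemma hausdorff_weight_ge0 s U : (0 <= hausdorff_weight s U)%E.
Proof.
by rewrite /hausdorff_weight; case: pselect => //= ?; exact: poweR_ge0.
Qed.

Lemma hausdorff_weight_ge s U (x y : R) : 0 <= s -> U x -> U y ->
  ((`|x - y| `^ s)%:E <= hausdorff_weight s U)%E.
Proof.
move=> s0 Ux Uy; rewrite /hausdorff_weight.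
case: pselect => [U0|/= ?]; first by rewrite U0 in Ux.
rewrite -poweR_EFin; apply: gt0_ler_poweR => //; last exact: diam_ge.
  by rewrite in_itv /= leey lee_fin normr_ge0.
by rewrite in_itv /= leey (le_trans _ (diam_ge Ux Uy)).
Qed.

Lemma hausdorff_weight_le s (r : R) U : 0 <= s -> 0 <= r ->
  (diam U <= r%:E)%E -> (hausdorff_weight s U <= (r `^ s)%:E)%E.
Proof.
move=> s0 r0 dU; rewrite /hausdorff_weight.
case: pselect => [U0 /=|U0 /=]; first by rewrite lee_fin powR_ge0.
have /set0P[x Ux] : U != set0 by exact/eqP.
rewrite -poweR_EFin; apply: gt0_ler_poweR => //.
  by rewrite in_itv /= leey (le_trans _ (diam_ge Ux Ux)).
by rewrite in_itv /= leey lee_fin r0.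
Qed.

Lemma hausdorff_premeasure_ge0 s (delta : R) A :
  (0 <= hausdorff_premeasure s delta A)%E.
Proof.
apply: le_ereal_inf_tmp => _ [U _ <-]; apply: nneseries_ge0 => i _ _.
exact: hausdorff_weight_ge0.
Qed.

Lemma hausdorff_measure_ge0 s A : (0 <= hausdorff_measure s A)%E.
Proof.
apply: (le_trans (hausdorff_premeasure_ge0 s 1 A)).
by apply: ereal_sup_ubound; exists 1 => /=.
Qed.

Lemma hausdorff_measure_eq0 s A :
  (forall delta, 0 < delta -> (hausdorff_premeasure s delta A <= 0)%E) ->
  hausdorff_measure s A = 0%E.
Proof.
move=> H; apply/eqP; rewrite eq_le hausdorff_measure_ge0 andbT.
by apply: ge_ereal_sup => _ [delta delta0 <-]; exact: H.
Qed.

(** A substitute for the mass distribution principle: given a cover [U] of [A],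
    the parameters [t] with [f t] in [U i] lie in an interval of length
    [2 * C] times the weight of [U i], and these intervals cover [0, 1[. *)
Lemma hausdorff_measure_gt0_of_holder s (C : R) A (f : R -> R) :
  0 <= s -> 0 < C ->
  (forall t, 0 <= t < 1 -> A (f t)) ->
  (forall t t', 0 <= t < 1 -> 0 <= t' < 1 ->
     `|t - t'| <= C * `|f t - f t'| `^ s) ->
  (0 < hausdorff_measure s A)%E.
Proof.
move=> s0 C0 fA fC.
pose mu := @lebesgue_measure R.
suff H : (((2 * C)^-1)%:E <= hausdorff_premeasure s 1 A)%E.
  apply: (@lt_le_trans _ _ (((2 * C)^-1)%:E)).
    by rewrite lte_fin invr_gt0 mulr_gt0.
  by apply: (le_trans H); apply: ereal_sup_ubound; exists 1 => /=.
apply: le_ereal_inf_tmp => _ [U [AU dU] <-].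
(* The weights are finite because the cover consists of sets of diameter at
   most 1. *)
have w_fin i : hausdorff_weight s (U i) \is a fin_num.
  rewrite ge0_fin_numE ?hausdorff_weight_ge0//.
  by apply: (le_lt_trans (hausdorff_weight_le s0 ler01 (dU i))); rewrite ltry.
have /choice[V VP] : forall i, exists V : set R,
    [/\ measurable V, (forall t, 0 <= t < 1 -> U i (f t) -> V t) &
        (mu V <= (2 * C)%:E * hausdorff_weight s (U i))%E].
  move=> i; pose w := fine (hausdorff_weight s (U i)).
  have wE : hausdorff_weight s (U i) = w%:E by rewrite fineK.
  have w0 : 0 <= w by rewrite fine_ge0// hausdorff_weight_ge0.
  have [[t0 [t01 Ut0]]|nU] := pselect (exists t, 0 <= t < 1 /\ U i (f t)).
    exists `[t0 - C * w, t0 + C * w]%classic; split => //.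
      move=> t t01' Ut /=; rewrite in_itv /= -ler_distlC.
      apply: (le_trans (fC _ _ t01 t01')).
      by rewrite ler_pM2l// -lee_fin -wE hausdorff_weight_ge.
    rewrite /mu lebesgue_measure_itv /= wE -EFinM.
    case: ifP => _; rewrite -?EFinD ?lee_fin; first by lra.
    by rewrite !mulr_ge0// ltW.
  exists set0; split => //.
    by move=> t t01 Ut; apply: nU; exists t.
  by rewrite /mu measure0 wE -EFinM lee_fin !mulr_ge0// ltW.
have mV : (mu (`[0%R, 1%R[%classic : set R) <= \sum_(0 <= i <oo) mu (V i))%E.
  apply: measure_sigma_subadditive => //.
    by move=> i; case: (VP i).
  move=> t /=; rewrite in_itv /= => t01.
  have [i _ Ui] := AU _ (fA _ t01).
  by exists i => //; case: (VP i) => _ + _; exact.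
rewrite -(@lee_pmul2l _ (2 * C)%:E)//; last by rewrite lte_fin mulr_gt0.
rewrite -EFinM divff ?gt_eqF ?mulr_gt0//.
rewrite -nneseriesZl; last by move=> i _; exact: hausdorff_weight_ge0.
rewrite /mu lebesgue_measure_itv /= lte01 sube0 in mV.
apply: (le_trans mV); apply: lee_nneseries => [i _ _|i _].
  exact: measure_ge0.
by case: (VP i).
Qed.

(** Cutting [0, 1] into [N] intervals of length [1 / N] gives total weight
    [N `^ (1 - s)], which tends to 0. *)
Lemma hausdorff_measure_itv01_eq0 s A : 1 < s ->
  (forall x, A x -> 0 <= x <= 1) -> hausdorff_measure s A = 0%E.
Proof.
move=> s1 A01; have s0 : 0 <= s by rewrite ltW// (lt_trans ltr01).
apply: hausdorff_measure_eq0 => delta delta0.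
apply/lee_addgt0Pr => e e0; rewrite add0e.
have [N [N0 Nd Ne]] : exists N : nat, [/\ (0 < N)%N, N%:R^-1 <= delta &
    N%:R * N%:R^-1 `^ s <= e].
  (* [b] solves [b `^ (1 - s) = e]. *)
  pose b := (e^-1) `^ ((s - 1)^-1).
  have b0 : 0 < b by rewrite powR_gt0// invr_gt0.
  pose N := (Num.truncn (b + delta^-1)).+1.
  have bN : b + delta^-1 < N%:R by apply: truncnS_gt.
  exists N; split=> //.
    rewrite -[leRHS]invrK lef_pV2 ?posrE ?invr_gt0//.
    by rewrite ltW// (le_lt_trans _ bN)// ler_wpDl// ltW.
  have Npos : 0 < N%:R :> R by [].
  rewrite -powR_inv1 // -powRrM mulN1r.
  rewrite -{1}(@powRr1 _ N%:R) // -powRD; last by rewrite (gt_eqF Npos) implybT.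
  rewrite -opprB powRN -[leRHS]invrK lef_pV2 ?posrE ?invr_gt0 ?powR_gt0//.
  have -> : e^-1 = b `^ (s - 1).
    by rewrite /b -powRrM mulVf ?powRr1 ?invr_ge0 ?ltW// gt_eqF// subr_gt0.
  apply: ge0_ler_powR; rewrite ?nnegrE ?subr_ge0 ?ltW//.
  by apply: le_lt_trans bN; rewrite ler_wpDr// invr_ge0 ltW.
have Npos : 0 < N%:R :> R by rewrite ltr0n.
pose U (i : nat) : set R :=
  if (i < N)%N then `[i%:R / N%:R, i.+1%:R / N%:R]%classic else set0.
have dU i : (diam (U i) <= (N%:R^-1)%:E)%E.
  apply: ge_ereal_sup => _ [[x y] /= [Ux Uy] <-]; move: Ux Uy.
  rewrite /U; case: ifP => //= _; rewrite !in_itv /= -natr1 mulrDl mul1r.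
  move=> /andP[? ?] /andP[? ?]; rewrite lee_fin ler_norml; lra.
apply: (@le_trans _ _ (\sum_(0 <= i <oo) hausdorff_weight s (U i))%E).
  apply: ereal_inf_lbound; exists U => //; split; last first.
    by move=> i; apply: (le_trans (dU i)); rewrite lee_fin.
  move=> x /A01 /andP[x0 x1].
  have [xlt|xge] := ltP x 1.
    exists (Num.truncn (x * N%:R)) => //.
    have xN0 : 0 <= x * N%:R by rewrite mulr_ge0// ltW.
    have /andP[h1 h2] := truncn_itv xN0.
    rewrite /U ifT; last first.
      by rewrite truncn_lt_nat// gtr_pMl.
    by rewrite /= in_itv /= ler_pdivrMr// h1 ler_pdivlMr// ltW.
  (* The intervals are closed, so the point 1 lies in the last one. *)
  exists N.-1 => //; rewrite /U prednK// leqnn /= in_itv /= divff ?gt_eqF// x1 andbT.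
  by apply: le_trans xge; rewrite ler_pdivrMr// mul1r ler_nat leq_pred.
rewrite (nneseries_split 0 N); last by move=> i _; exact: hausdorff_weight_ge0.
rewrite add0n [X in (_ + X)%E]eseries0; last first.
  move=> i Ni _; rewrite /U ltnNge Ni /= /hausdorff_weight.
  by case: pselect => [//|]; case.
rewrite adde0; apply: (@le_trans _ _ (N%:R * N%:R^-1 `^ s)%:E); last first.
  by rewrite lee_fin.
apply: (@le_trans _ _ (\sum_(0 <= i < N) (N%:R^-1 `^ s)%:E)%E).
  apply: lee_sum => i _; apply: hausdorff_weight_le => //.
by rewrite sumEFin big_const_nat subn0 iter_addr_0 mulr_natl.
Qed.

Lemma hausdorff_dim_set0 : hausdorff_dim (set0 : set R) = 0%E.
Proof.
apply/eqP; rewrite eq_le; apply/andP; split; last first.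
  by apply: le_ereal_inf_tmp => _ [s [s0 _] <-]; rewrite lee_fin.
apply: ereal_inf_lbound; exists 0 => //; split=> //=.
apply: hausdorff_measure_eq0 => delta delta0.
apply: ereal_inf_lbound; exists (fun=> set0).
  split=> // i; apply: ge_ereal_sup => _ [p [/= []]].
by apply: eseries0 => i _ _; rewrite /hausdorff_weight; case: pselect => [//|]; case.
Qed.

Lemma hausdorff_dim_eq1 A : (forall x, A x -> 0 <= x <= 1) ->
  (forall s, 0 <= s < 1 -> (0 < hausdorff_measure s A)%E) ->
  hausdorff_dim A = 1%E.
Proof.
move=> A01 Apos; apply/eqP; rewrite eq_le; apply/andP; split.
  apply/lee_addgt0Pr => e e0; apply: ereal_inf_lbound.
  exists (1 + e) => //; split=> /=; first by rewrite addr_ge0 // ltW.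
  by apply: hausdorff_measure_itv01_eq0 => //; rewrite ltrDl.
apply: le_ereal_inf_tmp => _ [s [/= s0 sH] <-]; rewrite lee_fin leNgt.
by apply/negP => s1; have := Apos s; rewrite s0 s1 sH ltxx => /(_ isT).
Qed.

End HausdorffBounds.

(** * Numbers with prescribed Pierce digits *)

Section PierceNumbers.
Variable R : realType.
Implicit Types (d : nat -> nat) (k n : nat).

Definition increasing_digits d := (0 < d 0)%N /\ forall n, (d n < d n.+1)%N.

Lemma increasing_digits_gt d n : increasing_digits d -> (n < d n)%N.
Proof.
move=> [d0 dS]; elim: n => [//|n IH]; exact: (leq_ltn_trans IH).
Qed.

(** The Pierce sum [1/d_n - 1/(d_n d_(n+1)) + ...] cut after [k] terms, written
    in nested form so that bounds follow by induction on [k]. *)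
Fixpoint pierce_convergent d k n : R :=
  if k is k'.+1 then (1 - pierce_convergent d k' n.+1) / (d n)%:R else 0.

Lemma pierce_convergentS d k n : pierce_convergent d k.+1 n =
  (1 - pierce_convergent d k n.+1) / (d n)%:R.
Proof. by []. Qed.

Definition pierce_tail d n : R := limn (fun k => pierce_convergent d k n).

Lemma pierce_convergent_itv d k n : increasing_digits d ->
  0 <= pierce_convergent d k n <= (d n)%:R^-1.
Proof.
move=> dI; elim: k n => [|k IH] n /=; first by rewrite lexx invr_ge0 ler0n.
have d0 m : 0 < (d m)%:R :> R.
  by rewrite ltr0n (leq_trans _ (increasing_digits_gt m dI)).
have /andP[h0 h1] := IH n.+1.
have h2 : (d n.+1)%:R^-1 <= 1 :> R.
  by rewrite invf_le1// ler1n -(ltr0n R).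
rewrite divr_ge0 ?subr_ge0 ?(le_trans h1)//=.
by rewrite -[leRHS]mul1r ler_pM2r ?invr_gt0// gerBl.
Qed.

(** The difference of consecutive convergents is divided by [d n] at each
    unfolding. Since [d 0] may be 1, a factor [1/2] per step is only available
    from [n = 1] on; the factor [2 / n.+1] makes the induction uniform in
    [n]. *)
Lemma pierce_convergent_step d k n : increasing_digits d ->
  `|pierce_convergent d k.+1 n - pierce_convergent d k n|
  <= 2 / n.+1%:R * 2^-1 ^+ k.
Proof.
move=> dI.
have dge m : m.+1%:R <= (d m)%:R :> R by rewrite ler_nat increasing_digits_gt.
have d0 m : 0 < (d m)%:R :> R by apply: lt_le_trans (dge m).
have dV m : (d m)%:R^-1 <= m.+1%:R^-1 :> R by rewrite lef_pV2 ?posrE.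
have dp m : 0 < (d m)%:R^-1 :> R by rewrite invr_gt0.
elim: k n => [|k IH] n.
  rewrite /= !subr0 mul1r expr0 mulr1 ger0_norm //.
  by apply: (le_trans (dV n)); rewrite -[leLHS]mul1r ler_pM2r ?invr_gt0 ?ler1n.
rewrite pierce_convergentS [pierce_convergent d k.+1 n]pierce_convergentS.
have IHn := IH n.+1; set a := pierce_convergent d k.+1 n.+1 in IHn *.
set b := pierce_convergent d k n.+1 in IHn *.
have -> : (1 - a) / (d n)%:R - (1 - b) / (d n)%:R = (b - a) / (d n)%:R by ring.
rewrite normrM [X in _ * X]ger0_norm // distrC.
apply: (le_trans (ler_pM _ _ IHn (dV n))) => //.
have u1 : 2 / n.+2%:R <= 1 :> R by rewrite ler_pdivrMr// mul1r ler_nat.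
have p0 : 0 <= 2^-1 ^+ k :> R by rewrite exprn_ge0.
have v0 : 0 <= n.+1%:R^-1 :> R by [].
rewrite exprS [leRHS](_ : _ = 1 * 2^-1 ^+ k * n.+1%:R^-1); last first.
  by set p := 2^-1 ^+ k; set v := n.+1%:R^-1; field.
by rewrite ler_wpM2r// ler_wpM2r.
Qed.

Lemma is_cvg_pierce_convergent d n : increasing_digits d ->
  cvgn (fun k => pierce_convergent d k n).
Proof.
move=> dI; set u := fun k => _.
rewrite [u](_ : _ = series (telescope u)); last first.
  by apply/funext => k; rewrite [LHS]eq_sum_telescope [u 0]/= add0r.
apply: normed_cvg.
apply: (series_le_cvg _ _ (fun k => pierce_convergent_step k n dI)) => [//|k|].
  by rewrite mulr_ge0// ?divr_ge0// exprn_ge0// invr_ge0.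
apply: (@is_cvg_geometric_series _ (2 / n.+1%:R) 2^-1).
by rewrite ger0_norm ?invr_ge0// invf_lt1// ltr1n.
Qed.

Lemma pierce_tailE d n : increasing_digits d ->
  pierce_tail d n = (1 - pierce_tail d n.+1) / (d n)%:R.
Proof.
move=> dI; apply: cvg_lim => //.
rewrite -cvg_shiftS; apply: cvgMl; apply: cvgB; first exact: cvg_cst.
exact: is_cvg_pierce_convergent.
Qed.

Lemma pierce_tail_itv d n : increasing_digits d ->
  0 < pierce_tail d n < (d n)%:R^-1.
Proof.
move=> dI.
have dgt m : m.+1%:R <= (d m)%:R :> R by rewrite ler_nat increasing_digits_gt.
have d0 m : 0 < (d m)%:R :> R by apply: lt_le_trans (dgt m).
have le m : 0 <= pierce_tail d m <= (d m)%:R^-1.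
  have c := is_cvg_pierce_convergent (n:=m) dI.
  apply/andP; split; [apply: limr_ge => //|apply: limr_le => //];
    by apply: nearW => k; case/andP: (pierce_convergent_itv k m dI).
have gt m : 0 < pierce_tail d m.
  rewrite pierce_tailE// divr_gt0// subr_gt0.
  have /andP[_ h] := le m.+1; apply: (le_lt_trans h).
  by rewrite invf_lt1// (lt_le_trans _ (dgt m.+1))// ltr1n.
rewrite gt /= pierce_tailE// -[ltRHS]mul1r ltr_pM2r ?invr_gt0//.
by rewrite gtrBl.
Qed.

(** Strict growth of the digits enters here: the next tail is less than
    [1 / d n.+1 <= 1 / (d n).+1]. With [pierce_tail_itv] this puts the tail
    strictly between [1 / (d n).+1] and [1 / d n], so its first digit is
    [d n]. *)
Lemma pierce_tail_gt d n : increasing_digits d ->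
  (d n).+1%:R^-1 < pierce_tail d n.
Proof.
move=> dI.
have d0 : 0 < (d n)%:R :> R.
  by rewrite ltr0n (leq_trans _ (increasing_digits_gt n dI)).
have /andP[_ h] := pierce_tail_itv n.+1 dI.
rewrite pierce_tailE// ltr_pdivlMr// mulrC -[ltLHS]opprK ltrNl -(ltrD2l 1).
have -> : 1 - (d n)%:R / (d n).+1%:R = (d n).+1%:R^-1 :> R.
  by rewrite -natr1; field; lra.
rewrite opprB addrCA subrr addr0 (lt_le_trans h)// lef_pV2 ?posrE//.
  by rewrite ler_nat dI.2.
by rewrite ltr0n (leq_ltn_trans _ (dI.2 n)).
Qed.

Lemma pierce_digit1_tail d n : increasing_digits d ->
  pierce_digit1 (pierce_tail d n) = d n :> int.
Proof.
move=> dI; have /andP[t0 t1] := pierce_tail_itv n dI.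
have t2 := pierce_tail_gt n dI.
have d0 : 0 < (d n)%:R :> R.
  by rewrite ltr0n (leq_trans _ (increasing_digits_gt n dI)).
apply: floor_def; rewrite -PoszD -!pmulrn addn1 div1r.
apply/andP; split.
  by rewrite -[leLHS]invrK lef_pV2 ?posrE ?invr_gt0 ?ltW.
by rewrite -[ltRHS]invrK ltf_pV2 ?posrE ?invr_gt0.
Qed.

Lemma iter_pierce_map_tail d n : increasing_digits d ->
  iter n (@pierce_map R) (pierce_tail d 0) = pierce_tail d n.
Proof.
move=> dI; elim: n => [//|n IH]; rewrite iterS IH.
rewrite /pierce_map pierce_digit1_tail// [X in _ * X]pierce_tailE//.
have d0 : 0 < (d n)%:R :> R.
  by rewrite ltr0n (leq_trans _ (increasing_digits_gt n dI)).
by rewrite -pmulrn mulrC divfK ?gt_eqF// subKr.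
Qed.

Lemma pierce_digit_tail d n : increasing_digits d ->
  pierce_digit n.+1 (pierce_tail d 0) = d n :> int.
Proof.
by move=> dI; rewrite /pierce_digit /= iter_pierce_map_tail// pierce_digit1_tail.
Qed.

(** If the number were rational with denominator [q], all its tails would be
    positive multiples of [1 / q], but the [n]-th one is less than
    [1 / d n]. *)
Lemma irrational_pierce_tail d : increasing_digits d ->
  irrational (pierce_tail d 0).
Proof.
move=> dI [q _ qE].
have q0 : 0 < (denq q)%:~R :> R by rewrite ltr0z denq_gt0.
have tail_int n : exists p : int, pierce_tail d n * (denq q)%:~R = p%:~R.
  elim: n => [|n [p pE]].
    exists (numq q); rewrite -qE /ratr divfK// gt_eqF//.
  exists (denq q - (d n)%:Z * p).
  have d0 : 0 < (d n)%:R :> R.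
    by rewrite ltr0n (leq_trans _ (increasing_digits_gt n dI)).
  have : pierce_tail d n * (d n)%:R = 1 - pierce_tail d n.+1.
    by rewrite pierce_tailE// divfK// gt_eqF.
  move=> h; rewrite intrB intrM -pE -pmulrn; nra.
pose n := `|denq q|%N.
have [p pE] := tail_int n.
have /andP[t0 t1] := pierce_tail_itv n dI.
have p1 : 1 <= p%:~R :> R.
  by rewrite ler1z -gtz0_ge1 -(ltr0z R) -pE mulr_gt0.
have nE : (denq q)%:~R = n%:R :> R by rewrite /n pmulrn absz_denq.
have dn : n%:R < (d n)%:R :> R by rewrite ltr_nat increasing_digits_gt.
have d0 : 0 < (d n)%:R :> R by apply: le_lt_trans dn.
have : pierce_tail d n * n%:R < 1.
  apply: (@lt_trans _ _ ((d n)%:R^-1 * n%:R)).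
    by rewrite ltr_pM2r// -nE.
  by rewrite mulrC ltr_pdivrMr// mul1r.
by rewrite -nE pE ltNge p1.
Qed.

End PierceNumbers.

(** * Mixed-radix digits *)

Section CantorDigits.
Variable R : realType.
Implicit Types (N : nat -> nat) (t : R).

(** The fractional part of [t * N 0 * ... * N n.-1]. *)
Fixpoint cantor_rest N t n : R :=
  if n is m.+1 then
    cantor_rest N t m * (N m)%:R -
    (Num.truncn (cantor_rest N t m * (N m)%:R))%:R
  else t.

Definition cantor_digit N t n := Num.truncn (cantor_rest N t n * (N n)%:R).

Lemma cantor_rest_itv N t n : 0 <= t < 1 -> 0 <= cantor_rest N t n < 1.
Proof.
move=> t01; elim: n => [//|n /andP[IH _] /=].
have r0 : 0 <= cantor_rest N t n * (N n)%:R by rewrite mulr_ge0.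
have := truncn_itv r0; rewrite -natr1; lra.
Qed.

Lemma cantor_digit_lt N t n : (0 < N n)%N -> 0 <= t < 1 ->
  (cantor_digit N t n < N n)%N.
Proof.
move=> N0 t01; have /andP[r0 r1] := cantor_rest_itv N n t01.
by rewrite truncn_lt_nat ?mulr_ge0// gtr_pMl// ltr0n.
Qed.

Lemma cantor_digits_dist N t t' n : (forall i, (0 < N i)%N) ->
  0 <= t < 1 -> 0 <= t' < 1 ->
  (forall i, (i < n)%N -> cantor_digit N t i = cantor_digit N t' i) ->
  `|t - t'| <= (\prod_(i < n) (N i)%:R)^-1.
Proof.
move=> N0 t01 t01' E.
have p0 m : 0 < \prod_(i < m) (N i)%:R :> R.
  by apply: prodr_gt0 => i _; rewrite ltr0n.
have -> : t - t' =
    (cantor_rest N t n - cantor_rest N t' n) / \prod_(i < n) (N i)%:R.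
  elim: n E => [|n IH] E; first by rewrite big_ord0 divr1.
  rewrite IH => [|i ni]; last by rewrite E// (ltn_trans ni).
  have := E n (leqnn _); rewrite /cantor_digit big_ord_recr /= => ->.
  by field; rewrite pnatr_eq0 -lt0n N0 gt_eqF ?p0.
rewrite normrM [X in _ * X]gtr0_norm ?invr_gt0// -[leRHS]mul1r.
rewrite ler_pM2r ?invr_gt0// ler_norml.
have := cantor_rest_itv N n t01; have := cantor_rest_itv N n t01'; lra.
Qed.

Lemma cantor_digits_inj N t t' : (forall i, (1 < N i)%N) ->
  0 <= t < 1 -> 0 <= t' < 1 ->
  (forall i, cantor_digit N t i = cantor_digit N t' i) -> t = t'.
Proof.
move=> N1 t01 t01' E; apply/eqP; rewrite -subr_eq0 -normr_eq0; apply/eqP.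
have N0 i : (0 < N i)%N by apply: ltnW.
apply/eqP; rewrite eq_le normr_ge0 andbT leNgt; apply/negP => h.
pose n := Num.truncn (`|t - t'|^-1).
have := cantor_digits_dist N0 t01 t01' (fun i (_ : (i < n.+1)%N) => E i).
apply/negP; rewrite -ltNge -[ltRHS]invrK ltf_pV2 ?posrE ?invr_gt0//; last first.
  by apply: prodr_gt0 => i _; rewrite ltr0n.
apply: (lt_le_trans (truncnS_gt _)); rewrite -/n -natr_prod ler_nat.
elim: n.+1 => [//|m IH]; rewrite big_ord_recr /=.
apply: (@leq_trans ((\prod_(i < m) N i) * 2)%N); last by rewrite leq_mul2l N1 orbT.
have : (0 < \prod_(i < m) N i)%N by apply: prodn_gt0.
by move: IH; set p := (\prod_(i < m) N i)%N; lia.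
Qed.

End CantorDigits.

(** * Pierce digits in prescribed windows *)

Section Windows.
Variable R : realType.
Implicit Types (a d : nat -> nat).

Lemma pierce_tail_dist d d' n : increasing_digits d -> increasing_digits d' ->
  (forall i, (i < n)%N -> d i = d' i) ->
  `|pierce_tail R d 0 - pierce_tail R d' 0| =
  `|pierce_tail R d n - pierce_tail R d' n| / \prod_(i < n) (d i)%:R.
Proof.
move=> dI dI'; elim: n => [|n IH] E; first by rewrite big_ord0 divr1.
rewrite IH => [|i ni]; last by rewrite E// (ltn_trans ni).
rewrite (pierce_tailE R n dI) (pierce_tailE R n dI') -E// big_ord_recr /=.
rewrite -mulrBl opprB addrC addrA subrK distrC normrM.
by rewrite [X in _ * X / _]ger0_norm// invfM -mulrA [X in _ * X]mulrC.
Qed.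

(** Say [d n < d' n]. Then [pierce_tail d n > 1 / (d n).+1 >= 1 / d' n], while
    [pierce_tail d' n] is less than [1 / d' n] by exactly
    [pierce_tail d' n.+1 / d' n], so the upper bound on the digit [d' n.+1] is
    what keeps the two numbers apart. *)
Lemma pierce_tail_separation a d d' n :
  increasing_digits d -> increasing_digits d' ->
  (forall i, (d i < a i.+1)%N) -> (forall i, (d' i < a i.+1)%N) ->
  (forall i, (i < n)%N -> d i = d' i) -> d n != d' n ->
  (\prod_(i < n.+2) (a i.+1)%:R)^-1 <=
  `|pierce_tail R d 0 - pierce_tail R d' 0|.
Proof.
move=> + + + + + dn.
wlog dlt : d d' dn / (d n < d' n)%N.
  move=> H dI dI' da da' E.
  have := dn; rewrite neq_ltn => /orP[h|h]; first exact: H.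
  rewrite distrC; apply: H => //; first by rewrite eq_sym.
  by move=> i ni; rewrite E.
move=> dI dI' da da' E.
have d0 m : 0 < (d m)%:R :> R.
  by rewrite ltr0n (leq_trans _ (increasing_digits_gt m dI)).
have d0' m : 0 < (d' m)%:R :> R.
  by rewrite ltr0n (leq_trans _ (increasing_digits_gt m dI')).
have a0 m : 0 < (a m.+1)%:R :> R by rewrite ltr0n (leq_ltn_trans _ (da m)).
rewrite (pierce_tail_dist dI dI' E).
have gap : ((a n.+1)%:R * (a n.+2)%:R)^-1 <= pierce_tail R d n - pierce_tail R d' n.
  apply: (@le_trans _ _ ((a n.+2)%:R^-1 / (d' n)%:R)).
    rewrite invfM mulrC ler_pM2l ?invr_gt0// lef_pV2 ?posrE// ler_nat.
    exact: ltnW.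
  apply: (@le_trans _ _ (pierce_tail R d' n.+1 / (d' n)%:R)).
    rewrite ler_pM2r ?invr_gt0//; apply: ltW; apply: le_lt_trans (pierce_tail_gt _ _ _) => //.
    by rewrite lef_pV2 ?posrE// ler_nat.
  rewrite [pierce_tail R d' n](pierce_tailE R n dI') mulrBl mul1r opprB.
  rewrite addrCA lerDl subr_ge0; apply: ltW.
  apply: le_lt_trans (pierce_tail_gt R n dI).
  by rewrite lef_pV2 ?posrE// ler_nat.
have p0 : 0 < \prod_(i < n) (d i)%:R :> R by apply: prodr_gt0.
have q0 : 0 < \prod_(i < n) (a i.+1)%:R :> R by apply: prodr_gt0.
rewrite !big_ord_recr /= -mulrA invfM mulrC; apply: ler_pM => //.
- by rewrite invr_ge0 (ltW q0).
- exact: le_trans (ler_norm _).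
- rewrite lef_pV2 ?posrE//; apply: ler_prod => i _.
  by rewrite ler0n ler_nat ltnW.
Qed.

(** The finitely many factors violating the inequality only cost a
    constant. *)
Lemma prod_le_const_prod (u v : nat -> R) : (forall n, 0 <= u n) ->
  (forall n, 0 < v n) -> (\forall n \near \oo, u n <= v n) ->
  exists2 C, 0 < C & forall n, \prod_(i < n) u i <= C * \prod_(i < n) v i.
Proof.
move=> u0 v0 [n0 _]; elim: n0 u v u0 v0 => [|n0 IH] u v u0 v0 uv.
  exists 1 => // n; rewrite mul1r; apply: ler_prod => i _.
  by rewrite u0 uv.
have [C C0 CP] := IH (fun n => u n.+1) (fun n => v n.+1)
  (fun n => u0 _) (fun n => v0 _) (fun n h => uv n.+1 h).
have e0 : 0 <= C * u 0%N / v 0%N by rewrite divr_ge0 ?mulr_ge0 ?(ltW C0) ?(ltW (v0 _)).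
exists (1 + C * u 0%N / v 0%N); first by rewrite ltr_wpDr.
case=> [|n]; first by rewrite !big_ord0 mulr1 lerDl.
have shift (w : nat -> R) :
    \prod_(i < n.+1) w i = w 0%N * \prod_(i < n) w i.+1 by rewrite big_ord_recl.
rewrite !shift; apply: (@le_trans _ _ (u 0%N * (C * \prod_(i < n) v i.+1))).
  by apply: ler_wpM2l => //; exact: CP.
have p0 : 0 < \prod_(i < n) v i.+1 by apply: prodr_gt0 => i _.
rewrite mulrA [leRHS]mulrA ler_pM2r// mulrDl mul1r divfK ?gt_eqF//.
by rewrite mulrC lerDr ltW.
Qed.

Lemma powR_prod (u : nat -> R) (s : R) n : (forall i, 0 <= u i) ->
  (\prod_(i < n) u i) `^ s = \prod_(i < n) u i `^ s.
Proof.
move=> u0; elim: n => [|n IH]; first by rewrite !big_ord0 powR1.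
by rewrite !big_ord_recr /= powRM ?IH// prodr_ge0.
Qed.

(** The index [n.+3] comes from the separation bound, which involves
    [a 1, ..., a n.+2], whereas the parameters are only known to agree up to
    [1 / (N 0 * ... * N n.-1)]. Comparing [N i] with [a i.+3] leaves out just
    the two factors [a 1] and [a 2], absorbed by the constant. *)
Lemma hausdorff_measure_gt0_of_windows a (A : set R) (s : R) :
  0 <= s -> (0 < a 0)%N -> (forall n, (a n).+2 <= a n.+1)%N ->
  (\forall n \near \oo, (a n.+3)%:R `^ s <= (a n.+1 - a n)%:R :> R) ->
  (forall x d, 0 < x <= 1 -> irrational x ->
     (forall n, pierce_digit n.+1 x = d n :> int /\ (a n <= d n < a n.+1)%N) ->
     A x) ->
  (0 < hausdorff_measure s A)%E.
Proof.
move=> s0 a0 a2 aN HA.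
pose N n := (a n.+1 - a n)%N.
have N1 n : (1 < N n)%N by rewrite /N; have := a2 n; lia.
have N0 n : (0 < N n)%N by apply: ltnW.
pose d (t : R) n := (a n + cantor_digit N t n)%N.
have da t n : 0 <= t < 1 -> (a n <= d t n < a n.+1)%N.
  move=> t01; rewrite leq_addr /=; have := cantor_digit_lt (N0 n) t01.
  rewrite /d {2}/N; have := a2 n; lia.
have dI t : 0 <= t < 1 -> increasing_digits (d t).
  move=> t01; split; first by have := da t 0%N t01; lia.
  by move=> n; have := da t n t01; have := da t n.+1 t01; lia.
have ap n : 0 < (a n.+1)%:R :> R by rewrite ltr0n; have := a2 n; lia.
have [C C0 CP] : exists2 C : R, 0 < C & forall n,
    (\prod_(i < n) (N i)%:R)^-1 <= C * (\prod_(i < n.+2) (a i.+1)%:R)^-1 `^ s.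
  have [|n|C C0 CP] := @prod_le_const_prod (fun n => (a n.+3)%:R `^ s)
    (fun n => (N n)%:R) _ _ aN.
  - by move=> n; exact: powR_ge0.
  - by rewrite ltr0n.
  exists (((a 1%N)%:R `^ s * (a 2%N)%:R `^ s) * C).
    by apply: mulr_gt0 => //; apply: mulr_gt0; exact: powR_gt0.
  move=> n.
  have p0 : 0 < \prod_(i < n) (N i)%:R :> R.
    by apply: prodr_gt0 => i _; rewrite ltr0n.
  have q0 : 0 < \prod_(i < n.+2) (a i.+1)%:R :> R by apply: prodr_gt0 => i _.
  rewrite -powR_inv1 ?(ltW q0)// -powRrM mulN1r powRN.
  rewrite ler_pdivlMr ?powR_gt0// mulrC ler_pdivrMr//.
  rewrite (@powR_prod (fun i => (a i.+1)%:R))// 2!big_ord_recl /= mulrA -[leRHS]mulrA.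
  by apply: ler_wpM2l; [rewrite mulr_ge0// powR_ge0|exact: CP].
apply: (@hausdorff_measure_gt0_of_holder R s C A (fun t => pierce_tail R (d t) 0)) => //.
  move=> t t01; have tI := dI t t01.
  have /andP[x0 x1] := pierce_tail_itv R 0 tI.
  apply: (HA _ (d t)).
  - rewrite x0 (le_trans (ltW x1))// invf_le1 ?ler1n ?ltr0n; exact: tI.1.
  - exact: irrational_pierce_tail.
  - by move=> n; split; [exact: pierce_digit_tail|exact: da].
move=> t t' t01 t01'.
have [->|tt'] := eqVneq t t'.
  by rewrite subrr normr0 mulr_ge0 ?powR_ge0 ?ltW.
have : exists n, cantor_digit N t n != cantor_digit N t' n.
  apply/not_existsP => h; move/eqP: tt'; apply.
  by apply: (cantor_digits_inj N1) => // i; apply/eqP/negPn/negP; exact: h.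
move=> /ex_minnP[n dn nmin].
have E i : (i < n)%N -> cantor_digit N t i = cantor_digit N t' i.
  by move=> ni; apply/eqP; apply: contraTT ni => /nmin; rewrite -leqNgt.
apply: (le_trans (cantor_digits_dist N0 t01 t01' E)); apply: (le_trans (CP n)).
rewrite ler_pM2l//; apply: ge0_ler_powR => //.
- by rewrite nnegrE invr_ge0 prodr_ge0.
apply: pierce_tail_separation; [exact: dI|exact: dI| | | |].
- by move=> i; case/andP: (da t i t01).
- by move=> i; case/andP: (da t' i t01').
- by move=> i ni; rewrite /d E.
- by rewrite /d eqn_add2l.
Qed.

End Windows.

(** * Windows of prescribed growth *)

Section GrowthWindows.
Variable R : realType.
Implicit Types (g : nat -> R) (alpha : \bar R) (s : R).

(** Windows [a n <= d n < a n.+1] with [a n] the least integer above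
    [expR (g n)]. Their length is at least [expR (g n) * (g n.+1 - g n) - 1], by
    convexity of the exponential, and the digit [d n] lies between [expR (g n)]
    and [expR (g n.+1)], whence the two limits. The constants 3 absorb the
    rounding. *)
Lemma hausdorff_measure_gt0_of_growth g alpha s : 0 <= s < 1 ->
  (forall n, 0 <= g n) ->
  (forall n, 3 <= expR (g n) * (g n.+1 - g n)) ->
  (\forall n \near \oo, 3 <= expR (g n - s * g n.+3) * (g n.+1 - g n)) ->
  (expR (g n / n.+1%:R))%:E @[n --> \oo] --> alpha ->
  (expR (g n.+1 / n.+1%:R))%:E @[n --> \oo] --> alpha ->
  (0 < hausdorff_measure s (digit_root_limit_set alpha))%E.
Proof.
move=> /andP[s0 s1] g0 gap growth liml limr.
pose a n := (Num.truncn (expR (g n))).+1.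
have a_gt n : expR (g n) < (a n)%:R by exact: truncnS_gt.
have trunc_le n : (Num.truncn (expR (g n)))%:R <= expR (g n).
  by rewrite truncn_le expR_ge0.
have a_le n : (a n)%:R <= expR (g n) + 1 by rewrite /a -natr1 lerD2r.
have step n : expR (g n) + expR (g n) * (g n.+1 - g n) <= expR (g n.+1).
  have -> : expR (g n.+1) = expR (g n) * expR (g n.+1 - g n).
    by rewrite -expRD addrC subrK.
  by rewrite -[X in X + _]mulr1 -mulrDr ler_pM2l ?expR_gt0// expR_ge1Dx.
have a_step n : ((a n).+2 <= a n.+1)%N.
  rewrite -(ler_nat R) -addn2 natrD.
  have := a_le n; have := a_gt n.+1; have := step n; have := gap n; lra.
apply: (@hausdorff_measure_gt0_of_windows R a) => //.
  near=> n.
  rewrite natrB; last by apply: ltnW; apply: ltnW.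
  apply: (@le_trans _ _ (2 * expR (s * g n.+3))).
    apply: (@le_trans _ _ ((2 * expR (g n.+3)) `^ s)).
      apply: ge0_ler_powR; rewrite ?nnegrE ?mulr_ge0 ?expR_ge0//.
      apply: (le_trans (a_le _)).
      have : 1 <= expR (g n.+3) by rewrite -expR0 ler_expR.
      lra.
    rewrite powRM ?expR_ge0// -expRM [g _ * s]mulrC ler_pM2r ?expR_gt0//.
    rewrite -[leRHS]powRr1//; apply: ler_powR; last exact: ltW.
    by rewrite ler1n.
  have h : 3 <= expR (g n - s * g n.+3) * (g n.+1 - g n) by near: n.
  have e1 : 1 <= expR (s * g n.+3) by rewrite -expR0 ler_expR mulr_ge0.
  have : 3 * expR (s * g n.+3) <= expR (g n) * (g n.+1 - g n).
    have -> : expR (g n) = expR (s * g n.+3) * expR (g n - s * g n.+3).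
      by rewrite -expRD addrC subrK.
    by rewrite -mulrA mulrC ler_pM2l ?expR_gt0.
  have := a_le n; have := a_gt n.+1; have := step n; lra.
move=> x d x01 xirr dP; split => //.
rewrite -cvg_shiftS; apply: (squeeze_cvge _ liml limr).
apply: nearW => n /=; have [-> /andP[ad da]] := dP n.
rewrite -pmulrn !lee_fin div1r !expRM.
have d_ge : expR (g n) <= (d n)%:R.
  by rewrite (le_trans (ltW (a_gt n)))// ler_nat.
have d_le : (d n)%:R <= expR (g n.+1).
  by apply: le_trans (trunc_le n.+1); rewrite ler_nat -ltnS.
by rewrite !ge0_ler_powR ?nnegrE ?expR_ge0.
Unshelve. all: by end_near. Qed.

(** The choice [g n = c * n + 2 * sqrt n + 2]: its increments are at least
    [1 / sqrt n.+1], negligible against [expR (2 * (1 - s) * sqrt n)], which is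
    up to a constant a lower bound for [expR (g n - s * g n.+3)]. This holds
    also for [c = 0]. *)
Lemma hausdorff_measure_digit_root_fin (c s : R) : 0 <= c -> 0 <= s < 1 ->
  (0 < hausdorff_measure s (digit_root_limit_set (expR c)%:E))%E.
Proof.
move=> c0 /andP[s0 s1].
have cn0 (n : nat) : 0 <= c * n%:R by rewrite mulr_ge0.
pose r n : R := Num.sqrt n%:R.
have r0 n : 0 <= r n by exact: sqrtr_ge0.
have rr n : r n ^+ 2 = n%:R by rewrite sqr_sqrtr.
pose g n := c * n%:R + 2 * r n + 2.
have r_gt0 n : 0 < r n.+1 by rewrite sqrtr_gt0 ltr0n.
have rS n : (r n.+1 - r n) * (r n.+1 + r n) = 1.
  by rewrite -subr_sqr !rr -natr1; lra.
have r_lt n : r n < r n.+1 by rewrite ltr_sqrt// ltr_nat.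
have gS n : (r n.+1)^-1 <= g n.+1 - g n.
  rewrite -[leLHS]mul1r ler_pdivrMr// /g -natr1.
  have := rS n; have := r_lt n; have := r0 n; have := r_gt0 n; nra.
have hE n : r n.+1 / n.+1%:R = Num.sqrt (@harmonic R n).
  rewrite /= sqrtrV// -/(r n.+1) -(rr n.+1); field; exact: lt0r_neq0.
have h0 : @harmonic R @ \oo --> 0 by exact: cvg_harmonic.
have lim (f : nat -> R) : (forall n, c - c / n.+1%:R <= f n
    <= c + 2 * (r n.+1 / n.+1%:R) + 2 / n.+1%:R) ->
    (expR (f n))%:E @[n --> \oo] --> (expR c)%:E.
  move=> fP; apply: cvg_EFin; first exact: nearW.
  apply: (continuous_cvg _ (@continuous_expR R c)).
  apply: (squeeze_cvgr (nearW _ fP)).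
    have : (fun n => c - c * harmonic n) @ \oo --> c - c * 0.
      by apply: cvgB; [exact: cvg_cst|exact: cvgMr].
    by rewrite mulr0 subr0.
  have : (fun n => c + 2 * Num.sqrt (harmonic n) + 2 * harmonic n) @ \oo -->
      c + 2 * Num.sqrt 0 + 2 * 0.
    apply: cvgD; last exact: cvgMr.
    apply: cvgD; [exact: cvg_cst|apply: cvgMr].
    exact: (continuous_cvg _ (@sqrt_continuous R 0) h0).
  rewrite sqrtr0 !mulr0 !addr0; under [X in X @ _ --> _ -> _]eq_fun do rewrite -hE.
  exact.
apply: (@hausdorff_measure_gt0_of_growth g); rewrite ?s0 //.
- by move=> n; rewrite /g !addr_ge0 ?mulr_ge0.
- move=> n; apply: (@le_trans _ _ (3 * (1 + 2 * r n) / r n.+1)).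
    rewrite ler_pdivlMr//.
    have := rr n; have := rr n.+1; rewrite -natr1; have := r0 n; have := r_gt0 n; nra.
  apply: ler_pM => //; last first.
    apply: (@le_trans _ _ (expR (2 * r n + 2))).
      rewrite expRD mulrC; apply: ler_pM => //.
      - by have := r0 n; lra.
      - exact: expR_ge1Dx.
      - by apply: le_trans (expR_ge1Dx _); lra.
    by rewrite ler_expR /g; have := cn0 n; lra.
    by rewrite invr_ge0.
  by rewrite mulr_ge0//; have := r0 n; lra.
- (* [s * (g n.+3 - g n) <= K]; the quadratic bound [y^2 / 2 <= expR y] with
     [y = 2 * (1 - s) * sqrt n] then suffices once [sqrt n >= M]. *)
  pose K := 3 * c + 4.
  pose M := 1 + 3 * expR K / (1 - s) ^+ 2.
  near=> n.
  have sp : 0 < (1 - s) ^+ 2 by rewrite exprn_gt0 ?subr_gt0.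
  have Mr : M <= r n.
    have : M ^+ 2 <= n%:R by near: n; exact: nbhs_infty_ger.
    rewrite -rr ler_sqr ?nnegrE//.
    by rewrite /M addr_ge0// divr_ge0 ?(ltW sp)// mulr_ge0// expR_ge0.
  have eK : 3 * expR K <= (1 - s) ^+ 2 * r n.
    rewrite [leRHS]mulrC -ler_pdivrMr//; move: Mr; rewrite /M; lra.
  have r1 : 1 <= r n.
    apply: le_trans Mr; rewrite lerDl divr_ge0 ?(ltW sp)// mulr_ge0// expR_ge0.
  have r3 : r n.+3 <= r n + 2.
    have := rr n; have := rr n.+3; rewrite -(natr1 n.+2) -(natr1 n.+1) -(natr1 n).
    have := r0 n; have := r0 n.+3; nra.
  have lb : 2 * (1 - s) * r n - K <= g n - s * g n.+3.
    rewrite /g /K -(natr1 n.+2) -(natr1 n.+1) -(natr1 n).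
    have h1 : 0 <= (1 - s) * (c * n%:R) by rewrite mulr_ge0// subr_ge0 ltW.
    have h2 : 0 <= (1 - s) * c by rewrite mulr_ge0// subr_ge0 ltW.
    have h3 : 0 <= s * (r n + 2 - r n.+3) by rewrite mulr_ge0// subr_ge0.
    lra.
  have eb : 2 * (1 - s) ^+ 2 * r n ^+ 2 / expR K <= expR (g n - s * g n.+3).
    apply: (@le_trans _ _ (expR (2 * (1 - s) * r n - K))); last by rewrite ler_expR.
    rewrite [leRHS]expRD expRN ler_pM2r ?invr_gt0 ?expR_gt0//.
    apply: le_trans (@expR_ge1Dxn _ _ 1 _); last first.
      by rewrite !mulr_ge0// subr_ge0 ltW.
    have -> : 2`!%:R = 2 :> R by [].
    lra.
  apply: (@le_trans _ _ (2 * (1 - s) ^+ 2 * r n ^+ 2 / expR K / r n.+1)).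
    rewrite !ler_pdivlMr ?expR_gt0//.
    have rS2 : r n.+1 <= 2 * r n.
      have := rr n; have := rr n.+1; rewrite -natr1; have := r0 n.+1; nra.
    apply: (@le_trans _ _ ((1 - s) ^+ 2 * r n * r n.+1)).
      by rewrite mulrAC ler_pM2r.
    apply: (@le_trans _ _ ((1 - s) ^+ 2 * r n * (2 * r n))).
      by rewrite ler_wpM2l// mulr_ge0// ltW.
    lra.
  apply: ler_pM => //.
    by rewrite divr_ge0 ?expR_ge0// mulr_ge0 ?exprn_ge0// mulr_ge0 ?(ltW sp).
  by rewrite invr_ge0.
- apply: lim => n; apply/andP; split.
    rewrite ler_pdivlMr// mulrBl divfK// /g -natr1; have := r0 n; lra.
  rewrite ler_pdivrMr// !mulrDl !divfK// -mulrA divfK// /g -natr1.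
  have := r_lt n; lra.
- apply: lim => n; apply/andP; split.
    rewrite ler_pdivlMr// mulrBl divfK// /g -natr1; have := r0 n.+1; lra.
  rewrite ler_pdivrMr// !mulrDl !divfK// -mulrA divfK// /g; lra.
Unshelve. all: by end_near. Qed.

Lemma hausdorff_measure_digit_root_pinfty (s : R) : 0 <= s < 1 ->
  (0 < hausdorff_measure s (digit_root_limit_set +oo%E))%E.
Proof.
move=> /andP[s0 s1].
pose g n : R := n%:R ^+ 2 + 2.
have gS n : g n.+1 - g n = 2 * n%:R + 1.
  by rewrite /g -natr1; ring.
have e3 : 3 <= expR 2 :> R.
  by apply: le_trans (expR_ge1Dx _); lra.
have cvgy (f : nat -> R) : (forall n, n%:R <= f n) -> (f n)%:E @[n --> \oo] --> +oo%E.
  move=> fn; apply: (@gee_cvgy _ _ _ _ (fun n => (n%:R)%:E)).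
    by apply: nearW => n; rewrite lee_fin.
  exact/cvgenyP.
apply: (@hausdorff_measure_gt0_of_growth g); rewrite ?s0 //.
- by move=> n; rewrite /g addr_ge0 ?exprn_ge0.
- move=> n; rewrite gS -[leLHS]mulr1; apply: ler_pM => //.
    by apply: (le_trans e3); rewrite ler_expR /g lerDr exprn_ge0.
  by rewrite lerDr mulr_ge0.
- near=> n; rewrite gS -[leLHS]mulr1; apply: ler_pM => //.
    apply: (le_trans e3); rewrite ler_expR /g.
    (* [(1 - s) * n ^ 2] has to exceed [s * (6 * n + 11)]. *)
    have : 17 / (1 - s) <= n%:R by near: n; exact: nbhs_infty_ger.
    rewrite ler_pdivrMr ?subr_gt0// => h.
    have n1 : 1 <= n%:R :> R.
      by rewrite ler1n; near: n; exact: nbhs_infty_gt.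
    rewrite -(natr1 n.+2) -(natr1 n.+1) -(natr1 n); nra.
  by rewrite lerDr mulr_ge0.
- apply: cvgy => n; apply: le_trans (expR_ge1Dx _).
  rewrite -lerBlDl ler_pdivlMr// /g -natr1; have : 0 <= n%:R :> R by []; nra.
- apply: cvgy => n; apply: le_trans (expR_ge1Dx _).
  rewrite -lerBlDl ler_pdivlMr// /g -natr1; have : 0 <= n%:R :> R by []; nra.
Unshelve. all: by end_near. Qed.

End GrowthWindows.

(** * Digits of irrational numbers *)

Section PierceDigits.
Variable R : realType.
Implicit Types x : R.

Lemma pierce_digit1_ge1 x : 0 < x <= 1 -> 1 <= pierce_digit1 x.
Proof.
move=> /andP[x0 x1]; rewrite /pierce_digit1 floor_ge_int div1r.
by rewrite invf_ge1.
Qed.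

Lemma pierce_map_irrational x : 0 < x <= 1 -> irrational x ->
  0 < pierce_map x <= 1 /\ irrational (pierce_map x).
Proof.
move=> x01 xirr; have m1 := pierce_digit1_ge1 x01.
have /andP[x0 x1] := x01.
have m1r : 1 <= (pierce_digit1 x)%:~R :> R by rewrite ler1z.
have m0r : (pierce_digit1 x)%:~R != 0 :> R by rewrite gt_eqF// (lt_le_trans ltr01).
have Tirr : irrational (pierce_map x).
  move=> [q _ qE]; apply: xirr; exists ((1 - q) / (pierce_digit1 x)%:~R) => //.
  rewrite fmorph_div rmorphB rmorph1 /= ratr_int qE /pierce_map.
  by rewrite subKr mulrC mulKf.
split=> //; rewrite lt_neqAle; apply/andP; split; last first.
  by rewrite /pierce_map gerBl mulr_ge0 ?ltW// (lt_le_trans ltr01).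
apply/andP; split.
  apply/eqP => T0; apply: Tirr; exists 0 => //; rewrite rmorph0; exact: T0.
rewrite /pierce_map subr_ge0 -ler_pdivlMr//; exact: ge_floor.
Qed.

Lemma iter_pierce_map_irrational x k : 0 < x <= 1 -> irrational x ->
  0 < iter k (@pierce_map R) x <= 1 /\ irrational (iter k (@pierce_map R) x).
Proof.
move=> x01 xirr; elim: k => [//|k [IH1 IH2]]; exact: pierce_map_irrational.
Qed.

Lemma digit_root_limit_set_eq0 (alpha : \bar R) : (alpha < 1)%E ->
  digit_root_limit_set alpha = set0.
Proof.
move=> a1; apply/seteqP; split=> // x [x01 xirr xlim].
suff : (1 <= alpha)%E by rewrite leNgt a1.
rewrite -(cvg_lim _ xlim)//; apply: lime_ge; first by apply/cvg_ex; exists alpha.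
apply: nearW => n; rewrite lee_fin.
have d1 : 1 <= (pierce_digit n x)%:~R :> R.
  rewrite ler1z; apply: pierce_digit1_ge1.
  by have [] := iter_pierce_map_irrational n.-1 x01 xirr.
rewrite -[leLHS](powRr0 (pierce_digit n x)%:~R); exact: ler_powR.
Qed.

End PierceDigits.

(** * The dimension of the digit-root level sets *)

Theorem corollary1p3 (R : realType) (alpha : \bar R) :
  ((1 <= alpha)%E -> hausdorff_dim (digit_root_limit_set alpha) = 1%E) /\
  ((alpha < 1)%E ->
     digit_root_limit_set alpha = set0 /\
     hausdorff_dim (digit_root_limit_set alpha) = 0%E).
Proof.
split=> [alpha1|alpha1]; last first.
  by have A0 := digit_root_limit_set_eq0 alpha1; rewrite A0 hausdorff_dim_set0.
apply: hausdorff_dim_eq1 => [x [/andP[x0 x1] _ _]|s s01]; first by rewrite x1 ltW.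
case: alpha alpha1 => [r|_|//]; last exact: hausdorff_measure_digit_root_pinfty.
rewrite lee_fin => r1; rewrite -[r]lnK ?posrE ?(lt_le_trans ltr01)//.
by apply: hausdorff_measure_digit_root_fin; rewrite ?ln_ge0.
Qed.
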